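(* If an odd perfect number $N$ is given in Eulerian form $N = q^k n^2$ (with Euler prime $q$), then $$I(q^k) < \frac{5}{4} < \sqrt{\frac{8}{5}} < I(n).$$
   Context: $\sigma(x)=\sum_{d\mid x} d$ denotes the sum of the positive divisors of the positive integer $x$, and $I(x) = \sigma(x)/x$ denotes the abundancy index of $x$. A positive integer $N$ is perfect if $\sigma(N) = 2N$. An odd perfect number $N$ is said to be given in Eulerian form if $N = q^k n^2$ where $q$ is a prime (called the Euler prime of $N$), $k$ and $n$ are positive integers, $q \equiv k \equiv 1 \pmod 4$ and $\gcd(q,n)=1$. *)

(* Defs.v *)
From mathcomp Require Import all_boot all_order all_algebra.
Set Implicit Arguments.
Unset Strict Implicit.
Unset Printing Implicit Defensive.
Import Order.TTheory GRing.Theory Num.Theory.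

Definition sigma (x : nat) : nat := \sum_(d <- divisors x) d.

Definition perfect (N : nat) : Prop := 0 < N /\ sigma N = 2 * N.

Definition abundancy (R : rcfType) (x : nat) : R := ((sigma x)%:R / x%:R)%R.

Definition eulerian_form (N q k n : nat) : Prop :=
  [/\ prime q, 0 < k /\ 0 < n, q = 1 %[mod 4] /\ k = 1 %[mod 4],
      coprime q n & N = q ^ k * n ^ 2].

(* Main.v *)
Require Import Defs.
From mathcomp Require Import all_boot all_order all_algebra.
From mathcomp Require Import zify lra.
Set Implicit Arguments.
Unset Strict Implicit.
Unset Printing Implicit Defensive.
Import Order.TTheory GRing.Theory Num.Theory.

(** The bound on [I(q^k)] is the geometric series: the divisors of [q^k] are
    powers of [q], so [I(q^k) < q / (q - 1)], and a prime congruent to 1 modulo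
    4 is at least 5, which gives [5/4].

    For [n], the point is that [I] is submultiplicative
    ([sigma_mul_leq]): every divisor of [a * b] is a divisor of [a] times a
    divisor of [b].  Hence [2 = I(N) <= I(q^k) * I(n)^2 < (5/4) * I(n)^2], so
    [I(n)^2 > 8/5].  All of this is done on natural numbers with denominators
    cleared; only the last step passes to the real closed field. *)

Lemma uniq_leq_sum (s t : seq nat) :
  uniq s -> {subset s <= t} -> \sum_(i <- s) i <= \sum_(i <- t) i.
Proof.
move=> us sst; apply: (sub_le_big_seq leqnn (fun x y => leq_addr y x)) => i.
rewrite count_uniq_mem //.
by case: (boolP (i \in s)) => // /sst; rewrite -has_pred1 has_count.
Qed.

Lemma dvdn_mul_factor (a b d : nat) :
  0 < d -> d %| a * b -> exists e f, [/\ e %| a, f %| b & d = e * f].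
Proof.
move=> d_gt0 dvd_d_ab; have g_gt0 : 0 < gcdn a d by rewrite gcdn_gt0 d_gt0 orbT.
exists (gcdn a d), (d %/ gcdn a d); split; first exact: dvdn_gcdl.
  (* d divides both a * b and d * b, hence gcd(a, d) * b. *)
  rewrite -(dvdn_pmul2l g_gt0) mulnC divnK ?dvdn_gcdr //.
  by rewrite muln_gcdl dvdn_gcd dvd_d_ab dvdn_mulr.
by rewrite mulnC divnK ?dvdn_gcdr.
Qed.

(** Expanding [sigma a * sigma b] lists every divisor of [a * b], possibly
    several times, as [e * f] with [e] dividing [a] and [f] dividing [b]. *)
Lemma sigma_mul_leq (a b : nat) :
  0 < a -> 0 < b -> sigma (a * b) <= sigma a * sigma b.
Proof.
move=> a_gt0 b_gt0; rewrite /sigma big_distrlr /=.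
rewrite -(big_allpairs_dep (h := fun e f : nat => e * f) (F := id)).
apply: uniq_leq_sum; first exact: divisors_uniq.
move=> d; rewrite -dvdn_divisors ?muln_gt0 ?a_gt0 // => dvd_d_ab.
have d_gt0 : 0 < d by apply: dvdn_gt0 dvd_d_ab; rewrite muln_gt0 a_gt0.
have [e [f [dvd_ea dvd_fb ->]]] := dvdn_mul_factor d_gt0 dvd_d_ab.
by apply: allpairs_f; rewrite -dvdn_divisors.
Qed.

(** The sum [1 + q + ... + q^k] is below [q^(k+1) / (q - 1)]; with denominators
    cleared, this is the bound [I(q^k) < q / (q - 1)]. *)
Lemma sigma_pfactor_ltn (q k : nat) :
  prime q -> q.-1 * sigma (q ^ k) < q * q ^ k.
Proof.
move=> q_pr; have q_gt0 := prime_gt0 q_pr.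
have le_geom : sigma (q ^ k) <= \sum_(i < k.+1) q ^ i.
  rewrite -(big_mkord xpredT) -(big_map (expn q) xpredT id).
  apply: uniq_leq_sum; first exact: divisors_uniq.
  move=> d; rewrite -dvdn_divisors ?expn_gt0 ?q_gt0 //.
  case/(dvdn_pfactor _ _ q_pr) => i le_ik ->; apply: map_f.
  by rewrite mem_index_iota.
apply: leq_ltn_trans (leq_mul (leqnn _) le_geom) _.
by rewrite -predn_exp expnS ltn_predL muln_gt0 q_gt0 expn_gt0 q_gt0.
Qed.

Lemma prime_mod4_1_geq5 (q : nat) : prime q -> q = 1 %[mod 4] -> 5 <= q.
Proof. by case: q => [|[|[|[|[|q]]]]]. Qed.

Lemma sigma_pfactor_mod4 (q k : nat) :
  prime q -> q = 1 %[mod 4] -> 4 * sigma (q ^ k) < 5 * q ^ k.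
Proof.
move=> q_pr q_mod4; have q_ge5 := prime_mod4_1_geq5 q_pr q_mod4.
have := sigma_pfactor_ltn k q_pr.
move: (q ^ k) (sigma (q ^ k)) => Q s; nia.
Qed.

(** Submultiplicativity, applied to [q^k * n^2] and again to [n * n], turns the
    upper bound on [I(q^k)] into a lower bound on [I(n)]: this is
    [I(n)^2 > 8/5] with denominators cleared. *)
Lemma sigma_sqr_gt (q k n : nat) :
  prime q -> q = 1 %[mod 4] -> 0 < n -> perfect (q ^ k * n ^ 2) ->
  8 * n ^ 2 < 5 * sigma n ^ 2.
Proof.
move=> q_pr q_mod4 n_gt0 [_ perfN].
have Q_gt0 : 0 < q ^ k by rewrite expn_gt0 prime_gt0.
have lt_s := sigma_pfactor_mod4 k q_pr q_mod4.
have n2_gt0 : 0 < n ^ 2 by rewrite expn_gt0 n_gt0.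
have le_prod : 2 * (q ^ k * n ^ 2) <= sigma (q ^ k) * sigma n ^ 2.
  rewrite -perfN; apply: leq_trans (sigma_mul_leq Q_gt0 n2_gt0) _.
  by rewrite leq_mul2l -!mulnn sigma_mul_leq ?orbT.
move: (q ^ k) (sigma (q ^ k)) (n ^ 2) (sigma n ^ 2) Q_gt0 lt_s n2_gt0 le_prod.
move=> Q s m t Q_gt0 lt_s m_gt0 le_prod.
rewrite -(ltn_pmul2l Q_gt0).
have t_gt0 : 0 < t by case: t le_prod => //; nia.
have : 4 * s * t < 5 * Q * t by rewrite ltn_pmul2r.
nia.
Qed.

Local Open Scope ring_scope.

Theorem lemma2p1 (R : rcfType) (N q k n : nat)
    (hodd : odd N) (hperf : perfect N) (hform : eulerian_form N q k n) :
  [/\ abundancy R (q ^ k)%N < 5 / 4,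
      (5 / 4 : R) < Num.sqrt (8 / 5) &
      Num.sqrt (8 / 5) < abundancy R n].
Proof.
case: hform => q_pr [_ n_gt0] [q_mod4 _] _ defN; rewrite defN in hperf.
have natr_pos (m : nat) : (0 < m)%N -> 0 < m%:R :> R by rewrite ltr0n.
split.
- have Q_gt0 : (0 < q ^ k)%N by rewrite expn_gt0 prime_gt0.
  rewrite /abundancy ltr_pdivrMr ?natr_pos //.
  have := sigma_pfactor_mod4 k q_pr q_mod4.
  rewrite -(ltr_nat R) !natrM; lra.
- rewrite -[ltLHS]ger0_norm -?sqrtr_sqr ?ltr_sqrt; lra.
- have I_ge0 : 0 <= abundancy R n by rewrite divr_ge0.
  rewrite -[ltRHS]ger0_norm // -sqrtr_sqr.
  have n2_gt0 : 0 < n%:R ^+ 2 :> R by rewrite exprn_gt0 ?natr_pos.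
  have lt_I2 : 8 / 5 < abundancy R n ^+ 2.
    rewrite /abundancy expr_div_n ltr_pdivlMr //.
    have := sigma_sqr_gt q_pr q_mod4 n_gt0 hperf.
    rewrite -(ltr_nat R) !natrM -!expr2; lra.
  by rewrite ltr_sqrt //; apply: lt_trans lt_I2; lra.
Qed.
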